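(* Let $R$ be a Dedekind domain with torsion class group, and suppose that $R$ is power separated and has the almost Dirichlet property. If $S$ is a Dedekind domain and $h:G(S)\longrightarrow G(R)$ is a homeomorphism of Golomb spaces, then $h$ sends almost prime elements of $S$ to almost prime elements of $R$.
   Context: All Dedekind domains are assumed not to be fields. For an integral domain $R$, put $R^\bullet := R\setminus\{0\}$. The Golomb space $G(R)$ is the set $R^\bullet$ with the topology generated by the coprime cosets of $R$, i.e. by the sets $x+I$ (as subsets of $R^\bullet$, i.e. $(x+I)\cap R^\bullet$) where $x\in R^\bullet$, $I$ is a nonzero ideal of $R$, and $\langle x, I\rangle = R$. For $A\subseteq R^\bullet$, $\overline{A}$ denotes the closure of $A$ in $G(R)$. An element $b$ of a Dedekind domain $R$ is almost prime if it is irreducible and is contained in a unique prime ideal. A Dedekind domain $R$ with torsion class group has the almost Dirichlet property if every coprime coset contains at least one almost prime element, i.e. the set of almost prime elements is dense in $G(R)$. For $a\in R$, $\mathrm{pow}(a):=\{ua^n\mid u\in U(R),\ n\geq 1\}$, where $U(R)$ is the group of units of $R$. For a maximal ideal $P$, $G_{\{P\}}(R)$ is the set of all nonzero $x\in R$ contained in $P$ and in no other prime ideal. A Dedekind domain $R$ with torsion class group is power separated if for every maximal ideal $P$ and every $b\in G_{\{P\}}(R)$ one has $\overline{\mathrm{pow}(b)}\cap G_{\{P\}}(R)=\mathrm{pow}(b)$. *)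

(* Defs.v *)
From HB Require Import structures.
From mathcomp Require Import all_boot all_order all_algebra.
From mathcomp Require Import boolp classical_sets topology.

Set Implicit Arguments.
Unset Strict Implicit.
Unset Printing Implicit Defensive.

Import GRing.Theory.
Local Open Scope classical_set_scope.
Local Open Scope ring_scope.

Section Ideals.
Variable R : idomainType.
Implicit Types (I J P M A : set R) (a b x y : R).

(* The whole ring is an ideal here, unlike the [idealr] of MathComp. *)
Definition is_ideal I :=
  [/\ I 0, forall x y, I x -> I y -> I (x + y) & forall a x, I x -> I (a * x)].

Definition nonzero_ideal I := is_ideal I /\ exists2 x, I x & x != 0.

Definition ideal_span A : set R := smallest is_ideal A.

Definition principal a : set R := [set a * x | x in setT].

Definition prime_ideal P :=
  [/\ is_ideal P, ~ P 1 & forall x y, P (x * y) -> P x \/ P y].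

Definition maximal_ideal M :=
  [/\ is_ideal M, M <> setT &
      forall J, is_ideal J -> M `<=` J -> J = M \/ J = setT].

Definition ideal_mul I J : set R := ideal_span [set x * y | x in I & y in J].

Definition ideal_exp I n : set R := iter n (ideal_mul I) setT.

End Ideals.

Definition noetherian (R : idomainType) :=
  forall I : set R, is_ideal I -> exists s : seq R, I = ideal_span [set` s].

Definition integrally_closed (R : idomainType) :=
  forall z : {fraction R},
    integralOver (@tofrac R) z -> exists r : R, z = tofrac r.

Definition not_a_field (R : idomainType) :=
  exists2 x : R, x != 0 & x \isn't a GRing.unit.

Definition dedekind (R : idomainType) :=
  [/\ not_a_field R, noetherian R, integrally_closed R &
      forall P : set R, prime_ideal P -> nonzero_ideal P -> maximal_ideal P].

(* The class group of a Dedekind domain is the set of nonzero ideals modulo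
   this relation, with the product of ideals as its operation. *)
Definition ideal_equiv (R : idomainType) (I J : set R) :=
  exists a b : R, [/\ a != 0, b != 0 &
    ideal_mul (principal a) I = ideal_mul (principal b) J].

(* The neutral element of the class group is the class of [setT]. *)
Definition torsion_class_group (R : idomainType) :=
  forall I : set R, nonzero_ideal I ->
    exists2 n, (0 < n)%N & ideal_equiv (ideal_exp I n) setT.

Definition golomb (R : idomainType) : Type := {x : R | x != 0}.

HB.instance Definition _ (R : idomainType) :=
  Choice.copy (golomb R) {x : R | x != 0}.

Definition coset (R : idomainType) (x : R) (I : set R) : set (golomb R) :=
  [set y | exists2 i, I i & sval y = x + i].

Definition coprime_coset (R : idomainType) : set (set (golomb R)) :=
  [set C | exists x : R, exists I : set R,
     [/\ x != 0, nonzero_ideal I, ideal_span (x |` I) = setT & C = coset x I]].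

HB.instance Definition _ (R : idomainType) :=
  isSubBaseTopological.Build (golomb R) (@coprime_coset R) id.

Definition homeomorphism (T U : topologicalType) (h : T -> U) :=
  exists g : U -> T, [/\ cancel h g, cancel g h, continuous h & continuous g].

Definition irreducible (R : idomainType) (b : R) :=
  [/\ b != 0, b \isn't a GRing.unit &
      forall x y : R, b = x * y -> x \is a GRing.unit \/ y \is a GRing.unit].

Definition almost_prime (R : idomainType) (b : R) :=
  irreducible b /\ exists! P : set R, prime_ideal P /\ P b.

Definition almost_dirichlet (R : idomainType) :=
  forall C : set (golomb R), coprime_coset C ->
    exists2 b : golomb R, C b & almost_prime (sval b).

Definition pow (R : idomainType) (a : golomb R) : set (golomb R) :=
  [set x | exists u : R, exists n : nat,
     [/\ u \is a GRing.unit, (0 < n)%N & sval x = u * sval a ^+ n]].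

Definition golomb_at (R : idomainType) (P : set R) : set (golomb R) :=
  [set x | P (sval x) /\ forall Q, prime_ideal Q -> Q (sval x) -> Q = P].

Definition power_separated (R : idomainType) :=
  forall P : set R, maximal_ideal P -> forall b : golomb R, golomb_at P b ->
    closure (pow b) `&` golomb_at P = pow b.

(* Main.v *)
Require Import Defs.
From mathcomp Require Import all_boot all_order all_algebra finmap ring.
From mathcomp Require Import boolp classical_sets topology.

(* Idea.  The closure of a coset [x + I] in the Golomb space is
   [{w | w^n (w - x) \in I for some n}].  From this one sees that the purely
   topological relation [top_dvd] below holds between [y] and [x] exactly when
   [y] divides a power of [x], so [h] and its inverse preserve this relation.
   It follows that [c = h b] lies in a single prime [P], that [P] contains an
   almost prime [p], and that the preimage of [p] is [v b^l] with [v] a unit.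
   Almost primes [r] close to [c] correspond to elements [s] close to [b], and
   then [v s^l] is close to [v b^l], so [h (v s^l)] is close to [p]; but it
   divides a power of [r], so it is [u r^j], which is close to [u c^j].  Hence
   [p] lies in the closure of [pow c], power separation gives [p = u' c^k], and
   irreducibility of [p] forces [k = 1]. *)

Set Implicit Arguments.
Unset Strict Implicit.
Unset Printing Implicit Defensive.

Import GRing.Theory.
Local Open Scope classical_set_scope.
Local Open Scope ring_scope.

(** * Ideals of a noetherian domain: induction, primes above an ideal, powers of an element modulo
    an ideal *)

Section Ideals.
Variable R : idomainType.
Implicit Types (I J P : set R) (x y d w : R).

Lemma ideal_mulr I a x : is_ideal I -> I x -> I (x * a).
Proof. by case=> _ _ IM Ix; rewrite mulrC; exact: IM. Qed.

Lemma idealB I x y : is_ideal I -> I x -> I y -> I (x - y).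
Proof. by case=> _ ID IM Ix Iy; apply: ID => //; rewrite -mulN1r; exact: IM. Qed.

Lemma ideal_setI I J : is_ideal I -> is_ideal J -> is_ideal (I `&` J).
Proof.
move=> [I0 ID IM] [J0 JD JM]; split=> //.
- by move=> x y [? ?] [? ?]; split; [exact: ID|exact: JD].
- by move=> a x [? ?]; split; [exact: IM|exact: JM].
Qed.

Lemma nonzero_ideal_setI I J :
  nonzero_ideal I -> nonzero_ideal J -> nonzero_ideal (I `&` J).
Proof.
move=> [iI [a Ia a0]] [iJ [b Jb b0]]; split; first exact: ideal_setI.
exists (a * b); last by rewrite mulf_neq0.
by split; [exact: ideal_mulr|case: iJ => _ _; exact].
Qed.

Lemma ideal_principal x : is_ideal (principal x).
Proof.
split; first by exists 0; rewrite ?mulr0.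
- by move=> _ _ [a _ <-] [b _ <-]; exists (a + b); rewrite ?mulrDr.
- by move=> a _ [b _ <-]; exists (a * b) => //; ring.
Qed.

Definition adjoin I x : set R := [set z | exists i r, I i /\ z = i + r * x].

Lemma ideal_adjoin I x : is_ideal I -> is_ideal (adjoin I x).
Proof.
move=> [I0 ID IM]; split.
- by exists 0, 0; rewrite mul0r addr0.
- move=> _ _ [i [r [Ii ->]]] [j [s [Ij ->]]].
  by exists (i + j), (r + s); split; [exact: ID|ring].
- move=> a _ [i [r [Ii ->]]].
  by exists (a * i), (a * r); split; [exact: IM|ring].
Qed.

Lemma sub_adjoin I x : I `<=` adjoin I x.
Proof. by move=> i Ii; exists i, 0; rewrite mul0r addr0. Qed.

Lemma mem_adjoin I x : is_ideal I -> adjoin I x x.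
Proof. by case=> I0 _ _; exists 0, 1; rewrite mul1r add0r. Qed.

Lemma ideal_span_sub (A : set R) I : is_ideal I -> A `<=` I -> ideal_span A `<=` I.
Proof. by move=> iI AI x; apply. Qed.

Lemma ideal_ideal_span (A : set R) : is_ideal (ideal_span A).
Proof.
split.
- by move=> I [[]].
- by move=> x y hx hy I IP; have [[_ ID _] _] := IP; apply: ID; [exact: hx|exact: hy].
- by move=> a x hx I IP; have [[_ _ IM] _] := IP; apply: IM; exact: hx.
Qed.

Lemma sub_ideal_span (A : set R) : A `<=` ideal_span A.
Proof. by move=> x Ax I [_]; exact. Qed.

Lemma ideal_span_seq (s : seq R) x : ideal_span [set` s] x ->
  exists c : 'I_(size s) -> R, x = \sum_i c i * s`_i.
Proof.
move=> sx.
apply: (@ideal_span_sub _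
  [set x | exists c : 'I_(size s) -> R, x = \sum_i c i * s`_i] _ _ x sx).
- split.
  + by exists (fun=> 0); rewrite big1 // => i _; rewrite mul0r.
  + move=> _ _ [c ->] [e ->]; exists (fun i => c i + e i).
    by rewrite -big_split; apply: eq_bigr => i _; rewrite mulrDl.
  + move=> a _ [c ->]; exists (fun i => a * c i).
    by rewrite mulr_sumr; apply: eq_bigr => i _; rewrite mulrA.
- move=> y /= ys; have iy : (index y s < size s)%N by rewrite index_mem.
  exists (fun i => (i == Ordinal iy)%:R).
  rewrite (bigD1 (Ordinal iy)) //= eqxx mul1r nth_index // big1 ?addr0 //.
  by move=> i /negPf ->; rewrite mul0r.
Qed.

(** A failure at [I0] would start, by choice, a strictly ascending chain of failures; its union is
    finitely generated, hence already equal to one member. *)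
Lemma noetherian_ind (Phi : set R -> Prop) : noetherian R ->
  (forall I, is_ideal I ->
    (forall J, is_ideal J -> I `<=` J -> J <> I -> Phi J) -> Phi I) ->
  forall I, is_ideal I -> Phi I.
Proof.
move=> noeR step I0 iI0; apply: contrapT => nPhi0.
pose bad I := is_ideal I /\ ~ Phi I.
have /choice [f fP] : forall I, exists J, bad I -> [/\ bad J, I `<=` J & J <> I].
  move=> I; have [[iI nPhi]|] := pselect (bad I); last by exists I.
  apply: contrapT => /forallNP noJ; apply: nPhi; apply: step => // J iJ IJ JI.
  by apply: contrapT => nJ; apply: (noJ J).
pose F n := iter n f I0.
have badF n : bad (F n) by elim: n => //= n /fP[].
have FS n : F n `<=` F n.+1 by have [] := fP _ (badF n).
have Fle m n : (m <= n)%N -> F m `<=` F n.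
  elim: n => [|n IH]; first by rewrite leqn0 => /eqP ->.
  by rewrite leq_eqVlt => /orP[/eqP -> //|/IH FmFn]; apply: subset_trans FmFn (FS n).
pose U := [set x | exists n, F n x].
have iU : is_ideal U.
  split; first by exists 0; case: iI0.
  - move=> x y [m xm] [n yn]; exists (maxn m n).
    have [[_ FD _] _] := badF (maxn m n).
    by apply: FD; [apply: (Fle m); rewrite ?leq_maxl|apply: (Fle n); rewrite ?leq_maxr].
  - by move=> a x [n xn]; exists n; have [[_ _ FM] _] := badF n; apply: FM.
have [s Us] := noeR U iU.
have [N sN] : exists N, forall x, x \in s -> F N x.
  have : forall x, x \in s -> U x by move=> x xs; rewrite Us; apply: sub_ideal_span.
  elim: s {Us} => [_|x s IH sU]; first by exists 0.
  have [y ys|N NP] := IH; first by apply: sU; rewrite inE ys orbT.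
  have [n xn] := sU x (mem_head _ _).
  exists (maxn n N) => y; rewrite inE => /orP[/eqP ->|/NP yN].
    by apply: (Fle n); rewrite ?leq_maxl.
  by apply: (Fle N); rewrite ?leq_maxr.
have [_ _] := fP _ (badF N); apply.
apply/seteqP; split; last exact: FS.
move=> x xN; have : U x by exists N.+1.
by rewrite Us; apply: ideal_span_sub => //; case: (badF N).
Qed.

Lemma prime_idealPn I : is_ideal I -> ~ I 1 -> ~ prime_ideal I ->
  exists x y, [/\ I (x * y), ~ I x & ~ I y].
Proof.
move=> iI I1 nI; apply: contrapT => /forallNP h; apply: nI; split => // x y Ixy.
apply: contrapT => /not_orP[Ix Iy]; have /forallNP := h x.
by apply; split; [exact: Ixy|exact: Ix|exact: Iy].
Qed.

(** If [x * y] is in [I] but neither factor is, then [I + (x)] is still proper, since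
    [1 = i + r * x] would put [y = i * y + r * (x * y)] in [I]. *)
Lemma prime_ideal_above I : noetherian R -> is_ideal I -> ~ I 1 ->
  exists2 P, prime_ideal P & I `<=` P.
Proof.
move=> noeR iI; move: I iI; apply: (noetherian_ind noeR) => I iI IH I1.
have [pI|/(prime_idealPn iI I1)[x [y [Ixy Ix Iy]]]] := pselect (prime_ideal I).
  by exists I.
have [|||[i [r [Ii e1]]]|P pP xP] := IH (adjoin I x).
- exact: ideal_adjoin.
- exact: sub_adjoin.
- by move=> e; apply: Ix; rewrite -e; apply: mem_adjoin.
- apply: Iy; have [_ ID IM] := iI.
  have -> : y = i * y + r * (x * y) by rewrite -[y in LHS]mul1r e1; ring.
  by apply: ID; [exact: ideal_mulr|exact: IM].
- by exists P => //; apply: subset_trans xP; exact: sub_adjoin.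
Qed.

Lemma prime_exp P x n : prime_ideal P -> P (x ^+ n) -> P x.
Proof.
move=> [_ P1 PM]; elim: n => [|n IH]; first by rewrite expr0.
by rewrite exprS => /PM[|/IH].
Qed.

Lemma nonunit_prime x : noetherian R -> x \isn't a GRing.unit ->
  exists2 P, prime_ideal P & P x.
Proof.
move=> noeR /negP xU; have [|P pP xP] := prime_ideal_above noeR (ideal_principal x).
  by move=> [y _ xy]; apply: xU; apply/unitrPr; exists y.
by exists P => //; apply: xP; exists 1; rewrite ?mulr1.
Qed.

Lemma prime_nonunit P x : prime_ideal P -> P x -> x \isn't a GRing.unit.
Proof.
move=> [iP P1 _] Px; apply/negP => xU; apply: P1.
by rewrite -(mulrV xU); exact: ideal_mulr.
Qed.

(* Modulo a nonzero ideal the descending powers of [x] stabilize. *)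
Lemma ideal_split I x : dedekind R -> nonzero_ideal I ->
  exists n q, I (x ^+ n * (1 - q * x)).
Proof.
move=> [_ noeR _ dim1] [iI nzI]; move: I iI nzI x.
apply: (noetherian_ind noeR) => I iI IH [d Id d0] x.
have [I1|I1] := pselect (I 1).
  by exists 0, 0; rewrite expr0 mul0r subr0 mulr1.
have [pI|/(prime_idealPn iI I1)[a [b [Iab Ia Ib]]]] := pselect (prime_ideal I).
  (* A nonzero prime is maximal, so modulo it [x] is zero or invertible. *)
  have [_ _ maxI] : maximal_ideal I by apply: dim1 => //; split=> //; exists d.
  have [e|e] := maxI _ (ideal_adjoin x iI) (@sub_adjoin I x).
    exists 1, 0; rewrite mul0r subr0 mulr1 expr1 -e; exact: mem_adjoin.
  have [i [r [Ii e1]]] : adjoin I x 1 by rewrite e.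
  exists 0, r; have -> : x ^+ 0 * (1 - r * x) = i; last by [].
  by rewrite expr0 mul1r e1 addrK.
have step y : ~ I y -> exists n q, adjoin I y (x ^+ n * (1 - q * x)).
  move=> Iy; apply: IH; first exact: ideal_adjoin.
  - exact: sub_adjoin.
  - by move=> e; apply: Iy; rewrite -e; exact: mem_adjoin.
  - by exists d => //; exact: sub_adjoin.
have [n [q [i [r [Ii ei]]]]] := step _ Ia.
have [m [p [j [s [Ij ej]]]]] := step _ Ib.
(* The coefficient is read off from [(1 - q * x) * (1 - p * x)]; the product of [I + (a)] and
   [I + (b)] lies in [I] because [a * b] does. *)
exists (n + m)%N, (q + p - q * p * x).
have -> : x ^+ (n + m) * (1 - (q + p - q * p * x) * x) =
    (j + s * b) * i + (r * a * j + r * s * (a * b)).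
  transitivity ((x ^+ n * (1 - q * x)) * (x ^+ m * (1 - p * x))).
    by rewrite exprD; ring.
  by rewrite ei ej; ring.
case: iI => _ ID IM; apply: (ID); first exact: IM.
by apply: ID; exact: IM.
Qed.

Lemma dvd_split x d : dedekind R -> x != 0 -> d != 0 ->
  exists n q c, 1 - q * x != 0 /\ x ^+ n.+1 * (1 - q * x) = d * c.
Proof.
move=> dR x0 d0.
have nzd : nonzero_ideal (principal d).
  by split; [exact: ideal_principal|exists d => //; exists 1; rewrite ?mulr1].
have [n [q [c _ e]]] := ideal_split x dR nzd.
have [z|z] := eqVneq (1 - q * x) 0.
  (* Shifting [q] by [d] turns the vanishing factor into [- (d * x)], which is nonzero and divisible
     by [d]. *)
  exists n, (q + d), (- x ^+ n.+2); split.
    have -> : 1 - (q + d) * x = - (d * x) by rewrite mulrDl opprD addrA z; ring.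
    by rewrite oppr_eq0 mulf_neq0.
  have -> : 1 - (q + d) * x = - (d * x) by rewrite mulrDl opprD addrA z; ring.
  by rewrite !exprS; ring.
exists n, q, (x * c); split=> //.
by rewrite exprS -mulrA -e; ring.
Qed.

End Ideals.

(** * Elements invertible modulo an ideal *)

Section Comaximal.
Variable R : idomainType.
Implicit Types (I J : set R) (x y w a : R).

Definition comaximal I x := exists r, I (1 - r * x).

Lemma comaximalP I x : is_ideal I -> comaximal I x <-> ideal_span (x |` I) = setT.
Proof.
move=> iI; split=> [[r Ir]|e].
  have [_ sD sM] := ideal_ideal_span (x |` I).
  apply/seteqP; split=> // z _.
  have -> : z = z * ((1 - r * x) + r * x) by ring.
  apply: (sM); apply: (sD); first by apply: sub_ideal_span; right.
  by apply: (sM); apply: sub_ideal_span; left.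
have [i [r [Ii e1]]] : adjoin I x 1.
  have : ideal_span (x |` I) 1 by rewrite e.
  apply: ideal_span_sub; first exact: ideal_adjoin.
  by move=> z [->|Iz]; [exact: mem_adjoin|exact: sub_adjoin].
by exists r; rewrite e1 addrK.
Qed.

Lemma comaximal_cancel I x a : is_ideal I -> comaximal I x -> I (x * a) -> I a.
Proof.
move=> iI [r Ir] Ixa; have [_ ID IM] := iI.
have -> : a = (1 - r * x) * a + r * (x * a) by ring.
by apply: ID; [exact: ideal_mulr|exact: IM].
Qed.

Lemma comaximalM I x y : is_ideal I ->
  comaximal I x -> comaximal I y -> comaximal I (x * y).
Proof.
move=> iI [r Ir] [s Is]; exists (r * s); have [_ ID IM] := iI.
have -> : 1 - r * s * (x * y) = (1 - r * x) + (r * x) * (1 - s * y) by ring.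
by apply: ID => //; exact: IM.
Qed.

Lemma comaximalX I x n : is_ideal I -> comaximal I x -> comaximal I (x ^+ n).
Proof.
move=> iI cx; elim: n => [|n IH]; last by rewrite exprS; exact: comaximalM.
by exists 1; rewrite expr0 mulr1 subrr; case: iI.
Qed.

Lemma comaximal_dvd I x y n a : is_ideal I -> x ^+ n = y * a ->
  comaximal I x -> comaximal I y.
Proof.
move=> iI e cx; have [r Ir] := comaximalX n iI cx.
by exists (r * a); rewrite -mulrA (mulrC a) -e.
Qed.

Lemma comaximal_exp_cancel I x a n : is_ideal I -> comaximal I x ->
  I (x ^+ n * a) -> I a.
Proof. by move=> iI cx; apply: comaximal_cancel => //; exact: comaximalX. Qed.

Lemma comaximal_setI I J x : is_ideal I -> is_ideal J ->
  comaximal I x -> comaximal J x -> comaximal (I `&` J) x.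
Proof.
move=> iI iJ [r Ir] [s Js]; exists (r + s - r * s * x); have [_ _ IM] := iI.
have [_ _ JM] := iJ.
have -> : 1 - (r + s - r * s * x) * x = (1 - s * x) * (1 - r * x) by ring.
by split; [exact: IM|exact: ideal_mulr].
Qed.

Lemma comaximal_adjoin I x r : is_ideal I -> comaximal (adjoin I (1 - r * x)) x.
Proof. by move=> iI; exists r; exact: mem_adjoin. Qed.

Lemma comaximal_cong I x y : is_ideal I -> I (y - x) ->
  comaximal I x -> comaximal I y.
Proof.
move=> iI Iyx [r Ir]; exists r; have [_ ID IM] := iI.
have -> : 1 - r * y = (1 - r * x) + (- r) * (y - x) by ring.
by apply: ID => //; exact: IM.
Qed.

Lemma ideal_congX I x y n : is_ideal I -> I (x - y) -> I (x ^+ n - y ^+ n).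
Proof. by move=> iI Ixy; rewrite subrXX; exact: ideal_mulr. Qed.

End Comaximal.

(** * Neighborhoods and closures in the Golomb space *)

Section Topology.
Variable R : idomainType.
Implicit Types (I J : set R) (x y w : golomb R).

Lemma coset_nbhs x I : nonzero_ideal I -> comaximal I (sval x) ->
  nbhs x (coset (sval x) I).
Proof.
move=> nzI cx; rewrite nbhsE; exists (coset (sval x) I); last by [].
split; last by exists 0; rewrite ?addr0 //; case: nzI => -[].
exists [set coset (sval x) I]; last by rewrite bigcup_set1.
move=> _ ->; exists [fset (coset (sval x) I : set (golomb R))]%fset.
  move=> C /fset1P ->; apply/mem_set; exists (sval x), I; split=> //.
    exact: (svalP x).
  by apply: (proj1 (comaximalP _ _)) cx; case: nzI.
by rewrite set_fset1 bigcap_set1.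
Qed.

(** Coprime cosets are declared as a subbase only. They form a base because an element invertible
    modulo [I] and modulo [J] is invertible modulo their intersection. *)
Lemma nbhs_coset x (U : set (golomb R)) : nbhs x U ->
  exists I, [/\ nonzero_ideal I, comaximal I (sval x) & coset (sval x) I `<=` U].
Proof.
rewrite nbhsE => -[V [[D' D'sub <-] [C D'C Cx]] VU].
have [F FD CE] := D'sub _ D'C.
suff [I [nzI cx IC]] : exists I, [/\ nonzero_ideal I, comaximal I (sval x) &
    forall A, A \in finmap.enum_fset F -> coset (sval x) I `<=` A].
  exists I; split=> // z zI; apply: VU.
  suff Cz : C z by exists C.
  by rewrite -CE => A AF; exact: IC zI.
have : forall A, A \in finmap.enum_fset F -> coprime_coset A /\ A x.
  move=> A AF; split; first by have := FD A AF; rewrite inE.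
  have : C x by [].
  by rewrite -CE; apply.
elim: (finmap.enum_fset F) => [_|A s IH sP].
  exists setT; split=> //; last by exists 0.
  by split=> //; exists 1 => //; exact: oner_neq0.
have [B Bs|I [nzI cx IC]] := IH; first by apply: sP; rewrite inE Bs orbT.
have [[a [J [_ nzJ sJ AE]]] Ax] := sP A (mem_head _ _).
have iI := proj1 nzI; have iJ := proj1 nzJ; have [_ JD _] := iJ.
have cJ := proj2 (comaximalP a iJ) sJ.
move: Ax; rewrite AE => -[j Jj xj].
exists (I `&` J); split; first exact: nonzero_ideal_setI.
  apply: comaximal_setI => //; apply: (@comaximal_cong _ _ a); last by exact: cJ.
  - by [].
  - by rewrite xj addrAC subrr add0r.
move=> B; rewrite inE => /orP[/eqP -> y [i [Ii Ji] yi]|Bs y [i [Ii _] yi]].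
  by exists (j + i); [exact: JD|rewrite yi xj addrA].
by apply: (IC B Bs); exists i.
Qed.

Hypothesis dR : dedekind R.

(** With [t] a nonzero nonunit, the coefficients 0, 1 and [t] give three distinct values, and only
    two are excluded. This serves to keep constructed elements away from 0 and from a given
    point. *)
Lemma exists_translate_neq2 (a p y1 y2 : R) : p != 0 ->
  exists c, a + c * p != y1 /\ a + c * p != y2.
Proof.
move=> p0; have [[t t0 tU] _ _ _] := dR; apply: contrapT => /forallNP h.
have t1 : t <> 1 by move=> t1; rewrite t1 unitr1 in tU.
have {}h c : a + c * p = y1 \/ a + c * p = y2.
  have [|n1] := eqVneq (a + c * p) y1; first by left.
  have [|n2] := eqVneq (a + c * p) y2; first by right.
  by case: (h c).
have inj c d (y : R) : a + c * p = y -> a + d * p = y -> c = d.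
  by move=> <- /esym /addrI /(mulIf p0).
have n10 : (1 : R) <> 0 by apply/eqP; exact: oner_neq0.
move/eqP: t0 => t0.
have [h0|h0] := h 0; have [h1|h1] := h 1; have [ht|ht] := h t;
  do ?[by case: n10; exact: inj h1 h0|by case: t0; exact: inj ht h0
      |by case: t1; exact: inj ht h1].
Qed.

Lemma closure_coset x I w : nonzero_ideal I ->
  closure (coset (sval x) I) w <-> exists n, I (sval w ^+ n * (sval w - sval x)).
Proof.
move=> nzI; have iI := proj1 nzI; have [_ ID IM] := iI.
have w0 : sval w != 0 := (svalP w).
split=> [clw|[n In] U /nbhs_coset[J [nzJ cw JU]]].
  (* The neighborhood of [w] modulo [I + (1 - q * w)] meets the coset, so [w - x] lies in that
     ideal, which [w ^+ n] multiplies into [I]. *)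
  have [n [q Iq]] := ideal_split (sval w) dR nzI.
  have iJ := ideal_adjoin (1 - q * sval w) iI.
  have nzJ : nonzero_ideal (adjoin I (1 - q * sval w)).
    by split=> //; case: nzI => _ [d Id d0]; exists d => //; exact: sub_adjoin.
  have [z [[i Ii zi] [j [k [r [Ik ->]] zj]]]] :=
    clw _ (coset_nbhs nzJ (@comaximal_adjoin _ I (sval w) q iI)).
  exists n.
  have -> : sval w ^+ n * (sval w - sval x) =
      sval w ^+ n * (i - k) - r * (sval w ^+ n * (1 - q * sval w)).
    have -> : sval x = sval z - i by rewrite zi addrK.
    by rewrite zj; ring.
  by apply: idealB => //; apply: IM => //; exact: idealB.
have iJ := proj1 nzJ; have [_ JD JM] := iJ.
have [r Jr] := comaximalX n iJ cw.
have [d [Id Jd] d0] := proj2 (nonzero_ideal_setI nzI nzJ).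
(* [v] is congruent to [x] modulo [I], and to [w] modulo [J] because [r] inverts [w ^+ n] there; a
   multiple of [d] is then added to avoid 0. *)
pose v := sval x + r * (sval w ^+ n * (sval w - sval x)).
have [c [vc _]] := exists_translate_neq2 v 0 0 d0.
exists (exist _ (v + c * d) vc); split.
  by exists (r * (sval w ^+ n * (sval w - sval x)) + c * d);
    [apply: ID; exact: IM|rewrite addrA].
apply: JU; exists ((1 - r * sval w ^+ n) * (sval x - sval w) + c * d).
  by apply: JD; [exact: ideal_mulr|exact: JM].
by rewrite /= /v; ring.
Qed.

End Topology.

(* In a Golomb space over a Dedekind domain, a nonzero prime [P] contains the
   intersection of the closures of suitable neighborhoods of [x] and of some
   [x'] exactly when [x] is not in [P]. *)
Definition top_dvd (T : topologicalType) (y x : T) :=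
  forall x' U U', x' <> x -> nbhs x U -> nbhs x' U' ->
  exists y' W W', [/\ y' <> y, nbhs y W, nbhs y' W' &
    closure W `&` closure W' `<=` closure U `&` closure U'].

Lemma top_dvd_homeo (T U : topologicalType) (f : T -> U) (g : U -> T) y x :
  cancel f g -> cancel g f -> continuous f -> continuous g ->
  top_dvd y x -> top_dvd (f y) (f x).
Proof.
move=> fK gK cf cg yx x' V V' x'x xV x'V'.
have clf (W : set T) t : closure W t -> closure (f @` W) (f t).
  move=> clW B /cf tB; have [s [Ws Bs]] := clW _ tB.
  by exists (f s); split=> //; exists s.
have nbf (W : set T) t : nbhs t W -> nbhs (f t) (f @` W).
  move=> tW; have : nbhs (g (f t)) W by rewrite fK.
  by move/(cg (f t)); apply: (@filterS _ (nbhs (f t)) _ (g @^-1` W)) => s Ws; exists (g s).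
have clg (W : set U) s : closure (f @^-1` W) (g s) -> closure W s.
  move=> /clf; rewrite gK; apply: closureS => _ [t Wt <-]; exact: Wt.
have clg' (W : set T) s : closure (f @` W) s -> closure W (g s).
  move=> clW B /cg sB; have [_ [[t Wt <-] Bs]] := clW _ sB.
  by exists t; split=> //; rewrite -(fK t).
have [||| y' [W [W' [y'y yW y'W' sub]]]] := yx (g x') (f @^-1` V) (f @^-1` V').
- by move=> e; apply: x'x; rewrite -e gK.
- exact: cf.
- by apply: cf; rewrite gK.
exists (f y'), (f @` W), (f @` W'); split.
- by move/(can_inj fK).
- exact: nbf.
- exact: nbf.
- by move=> s [/clg' sW /clg' sW']; have [? ?] := sub _ (conj sW sW'); split; exact: clg.
Qed.

(** * Topological divisibility is divisibility into a power *)

Section TopDvd.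
Variable R : idomainType.
Hypothesis dR : dedekind R.
Implicit Types (I J P : set R) (x y w : golomb R).

(** The exponent 0 is harmless: it forces [x] to be a unit. *)
Definition radical_dvd x y := exists n c, sval y ^+ n = sval x * c.

(** Strips from [(e)] the primes containing [x]: if [x ^+ n * (1 - q * x)] is in [(e)], take
    [J = (e) + (1 - q * x)]. *)
Lemma comaximal_split (x e : R) : e != 0 -> exists J n,
  [/\ nonzero_ideal J, comaximal J x & forall j, J j -> exists c, x ^+ n * j = e * c].
Proof.
move=> e0; have iE := ideal_principal e.
have nzE : nonzero_ideal (principal e) by split=> //; exists e => //; exists 1; rewrite ?mulr1.
have [n [q [c _ ec]]] := ideal_split x dR nzE.
exists (adjoin (principal e) (1 - q * x)), n; split.
- split; first exact: ideal_adjoin.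
  by exists e => //; apply: sub_adjoin; exists 1; rewrite ?mulr1.
- exact: comaximal_adjoin.
- move=> _ [_ [r [[a _ <-] ->]]]; exists (x ^+ n * a + r * c).
  transitivity (e * (x ^+ n * a) + r * (x ^+ n * (1 - q * x))); first by ring.
  by rewrite -ec; ring.
Qed.

(** Otherwise some prime [P] contains [y] but not [x]. Then [x] and a suitable [x'] have
    neighborhoods whose closures meet only inside [P], whereas closures of neighborhoods of [y] and
    any [y'] always share a point outside [P]. *)
Lemma top_dvd_radical y x : top_dvd y x -> radical_dvd y x.
Proof.
move=> yx; apply: contrapT => nyx.
have [y0 x0] : sval y != 0 /\ sval x != 0 by split; [exact: (svalP y)|exact: (svalP x)].
have [_ noeR _ _] := dR.
have [n0 [q [c [_ e]]]] := dvd_split dR x0 y0.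
have [P [pP Py nPx]] : exists P, [/\ prime_ideal P, P (sval y) & ~ P (sval x)].
  have iJ := ideal_adjoin (1 - q * sval x) (ideal_principal (sval y)).
  have [|P pP JP] := prime_ideal_above noeR iJ.
    case=> _ [r [[a _ <-] e1]]; apply: nyx; exists n0.+1.
    exists (sval x ^+ n0.+1 * a + r * c).
    rewrite -[LHS]mulr1 e1 mulrDr (mulrCA _ r) e; ring.
  have [iP P1 _] := pP; have [_ PD PM] := iP.
  have PJ : P (sval y) by apply: JP; apply: sub_adjoin; exists 1; rewrite ?mulr1.
  exists P; split=> // Px; apply: P1.
  have -> : 1 = (1 - q * sval x) + q * sval x by ring.
  apply: PD; last exact: PM.
  by apply: JP; apply: mem_adjoin; exact: ideal_principal.
have [iP P1 PP] := pP; have [_ PD PM] := iP.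
have [c1 [z0 zx]] := exists_translate_neq2 dR (sval x) 0 (sval x) y0.
set p := c1 * sval y in z0 zx.
have Pp : P p by exact: PM.
have p0 : p != 0 by apply: contraNneq zx => ->; rewrite addr0.
pose x' : golomb R := exist _ (sval x + p) z0.
have nPx' : ~ P (sval x').
  by move=> /= Pxp; apply: nPx; rewrite -(addrK p (sval x)); exact: idealB.
(* The square is needed because one factor [p = x' - x] gets cancelled when the two closure
   conditions are subtracted. *)
have pp0 : p * p != 0 by rewrite mulf_neq0.
have [I [n1 [nzI cI Ip]]] := comaximal_split (sval x) pp0.
have [I' [n2 [nzI' cI' Ip']]] := comaximal_split (sval x') pp0.
have [|y' [W [W' [_ yW y'W' sub]]]] :=
    yx x' _ _ _ (coset_nbhs nzI cI) (coset_nbhs nzI' cI').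
  by move=> /(congr1 sval) /eqP; rewrite (negbTE zx).
have [K [nzK [r Kr] KW]] := nbhs_coset yW.
have [K' [nzK' [r' Kr'] KW']] := nbhs_coset y'W'.
have iK := proj1 nzK; have iK' := proj1 nzK'.
have KP w : (exists n, K (sval w ^+ n * (sval w - sval y))) ->
    (exists n, K' (sval w ^+ n * (sval w - sval y'))) -> P (sval w).
  move=> /(closure_coset dR _ _ nzK) wK /(closure_coset dR _ _ nzK') wK'.
  have [] := sub w (conj (closureS KW wK) (closureS KW' wK')).
  move=> /(closure_coset dR _ _ nzI)[m1 /Ip[f1 e1]].
  move=> /(closure_coset dR _ _ nzI')[m2 /Ip'[f2 e2]].
  suff : P (sval x ^+ n1 * sval x' ^+ n2 * (sval w ^+ m1 * sval w ^+ m2)).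
    by move=> /PP[/PP[]|/PP[]] /(prime_exp pP).
  have -> : sval x ^+ n1 * sval x' ^+ n2 * (sval w ^+ m1 * sval w ^+ m2) =
      (sval x' ^+ n2 * sval w ^+ m2 * f1 - sval x ^+ n1 * sval w ^+ m1 * f2) * p.
    apply: (mulIf p0); rewrite -[RHS]mulrA mulrBl.
    rewrite -![_ * f1 * _]mulrA -![_ * f2 * _]mulrA ![_ * (p * p)]mulrC -e1 -e2.
    by rewrite /=; ring.
  exact: PM.
have [t [Kt Kt'] t0] := proj2 (nonzero_ideal_setI nzK nzK').
have [Py'|nPy'] := pselect (P (sval y')).
  (* [w] lies in both [K] and [K'], hence in both closures, and is 1 modulo [P]. *)
  pose w := (1 - r * sval y) * (1 - r' * sval y').
  have nPw : ~ P w.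
    move=> Pw; apply: P1.
    have -> : 1 = w + (r * sval y + (1 - r * sval y) * r' * sval y') by rewrite /w; ring.
    by apply: (PD) => //; apply: PD; exact: PM.
  have w0 : w != 0 by apply/eqP => w0; apply: nPw; rewrite w0; case: iP.
  apply: nPw; apply: (KP (exist _ w w0)); exists 1; apply: ideal_mulr => //=.
  - by rewrite expr1; exact: ideal_mulr.
  - by rewrite expr1 /w mulrC; exact: ideal_mulr.
(* Now [y'] is outside [P]. The element [v] built here is 1 modulo [P], lies in [K], and [t] divides
   [y ^+ n3.+1 * v]; the point wanted is [y' * v]. *)
have [n3 [s [f [_ ef]]]] := dvd_split dR y0 t0.
have [|r1 [b _ eb]] := @comaximalX _ (principal (1 - s * sval y)) (sval y) n3.+1
    (ideal_principal _).
  by exists s; exists 1; rewrite ?mulr1.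
pose v := 1 - r1 * sval y ^+ n3.+1.
have yv : sval y ^+ n3.+1 * v = t * (f * b) by rewrite /v -eb mulrA ef mulrA.
have Kv : K v.
  apply: (@comaximal_exp_cancel _ K (sval y) v n3.+1 iK); first by exists r.
  by rewrite yv; exact: ideal_mulr.
have nPw : ~ P (sval y' * v).
  move=> /PP[//|Pv]; apply: P1.
  have -> : 1 = v + (r1 * sval y ^+ n3) * sval y by rewrite /v exprSr; ring.
  by apply: PD => //; exact: PM.
have w0 : sval y' * v != 0 by apply/eqP => w0; apply: nPw; rewrite w0; case: iP.
apply: nPw; apply: (KP (exist _ (sval y' * v) w0)); exists 1; rewrite expr1 /=.
  by apply: ideal_mulr => //; case: iK => _ _; exact.
have -> : sval y' * v * (sval y' * v - sval y') =
    t * (- (f * b) * sval y' ^+ 2 * r1).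
  have -> : t * (- (f * b) * sval y' ^+ 2 * r1) =
    - (t * (f * b)) * (sval y' ^+ 2 * r1) by ring.
  by rewrite -yv {2}/v; ring.
exact: ideal_mulr.
Qed.

(** Here [d] in both ideals divides [X * g], with [X] a power of [x] and [g] coprime to [x], hence
    to [y]. The point [y'] is chosen so that every [w] in both new closures has a power divisible by
    [g]; then [d] divides [X * w ^+ l]. *)
Lemma radical_top_dvd y x : radical_dvd y x -> top_dvd y x.
Proof.
move=> [a0 [b0 e0]] x' U U' x'x /nbhs_coset[I [nzI cI IU]] /nbhs_coset[I' [nzI' cI' IU']].
have iI := proj1 nzI; have iI' := proj1 nzI'.
have [y0 x0] : sval y != 0 /\ sval x != 0 by split; [exact: (svalP y)|exact: (svalP x)].
have [d [Id Id'] d0] := proj2 (nonzero_ideal_setI nzI nzI').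
have [N [q [c [g0 e]]]] := dvd_split dR x0 d0.
set g := 1 - q * sval x in g0 e; pose X := sval x ^+ N.+1.
have iG := ideal_principal g.
have cGx : comaximal (principal g) (sval x) by exists q; exists 1; rewrite ?mulr1.
have [al [be _ ab]] := comaximalX N.+1 iG cGx.
have Xg0 : X * g != 0 by rewrite mulf_neq0 // expf_neq0.
(* By the Chinese remainder theorem, [z] is 1 modulo [g] and [x'] modulo [X]; the multiple of
   [X * g] keeps it off 0 and [y]. *)
have [c1 [z0 zy]] := exists_translate_neq2 dR (al * X + g * be * sval x') 0 (sval y) Xg0.
set z := _ + _ in z0 zy.
have del0 : sval y - z != 0 by rewrite subr_eq0 eq_sym.
have gd0 : g * (sval y - z) != 0 by rewrite mulf_neq0.
have gdd0 : g * (sval y - z) * d != 0 by rewrite mulf_neq0.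
have [K [n1 [nzK cK Kp]]] := comaximal_split (sval y) gd0.
have [K' [n2 [nzK' cK' Kp']]] := comaximal_split z gdd0.
pose y' : golomb R := exist _ z z0.
exists y', (coset (sval y) K), (coset (sval y') K'); split.
- by move=> /(congr1 sval) /eqP; rewrite (negbTE zy).
- exact: coset_nbhs.
- exact: coset_nbhs.
move=> w [/(closure_coset dR _ _ nzK)[n /Kp[f1 e1]]].
move=> /(closure_coset dR _ _ nzK')[m /Kp'[f2 /= e2]].
pose l := (n + m)%N.
(* Subtracting the two closure conditions and cancelling [y - z] shows that [g] divides
   [y ^+ n1 * z ^+ n2 * w ^+ l], where [y] and [z] are invertible modulo [g]. *)
have [f _ wl] : principal g (sval w ^+ l).
  have cGy := comaximal_dvd iG e0 cGx.
  have cGz : comaximal (principal g) z.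
    apply: (@comaximal_cong _ _ 1) => //; last first.
      by exists 1; rewrite mulr1 subrr; case: iG.
    exists (be * sval x' + c1 * X - be) => //.
    rewrite mulrBr ab /z /X; ring.
  apply: (comaximal_exp_cancel (n := n1) iG cGy).
  apply: (comaximal_exp_cancel (n := n2) iG cGz).
  exists (sval y ^+ n1 * sval w ^+ n * d * f2 - z ^+ n2 * sval w ^+ m * f1) => //.
  apply: (mulIf del0).
  transitivity (sval y ^+ n1 * sval w ^+ n * (g * (sval y - z) * d * f2) -
     z ^+ n2 * sval w ^+ m * (g * (sval y - z) * f1)); first by ring.
  by rewrite -e1 -e2 /l exprD; ring.
have Xw : X * sval w ^+ l = d * (c * f) by rewrite -wl mulrA e mulrA.
split.
  apply: (closureS IU); apply/(closure_coset dR _ _ nzI); exists l.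
  apply: (comaximal_exp_cancel (n := N.+1) iI cI).
  by rewrite mulrA Xw -mulrA; exact: ideal_mulr.
apply: (closureS IU'); apply/(closure_coset dR _ _ nzI'); exists (l + m)%N.
have [_ ID IM] := iI'.
apply: (comaximal_exp_cancel (n := n2) iI' cI').
(* [X] divides [z - x'], so the factor [X * w ^+ l], a multiple of [d], appears. *)
have zx' : I' (sval w ^+ l * (z - sval x')).
  have -> : sval w ^+ l * (z - sval x') =
      X * sval w ^+ l * (al * (1 - sval x') + c1 * g).
    have -> : z = (1 - g * be) + g * be * sval x' + c1 * (X * g) by rewrite /z ab /X; ring.
    have -> : 1 - g * be = al * X by rewrite ab /X; ring.
    have -> : g * be = 1 - al * X by [].
    ring.
  by rewrite Xw -mulrA; exact: ideal_mulr.
have -> : sval x' ^+ n2 * (sval w ^+ (l + m) * (sval w - sval x')) =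
    sval w ^+ l * (z ^+ n2 * (sval w ^+ m * (sval w - z))) +
    z ^+ n2 * sval w ^+ m * (sval w ^+ l * (z - sval x')) -
    sval w ^+ m * (sval w - sval x') * (sval w ^+ l * (z ^+ n2 - sval x' ^+ n2)).
  by rewrite exprD; ring.
apply: idealB => //.
  apply: ID; last exact: IM.
  by apply: (IM); rewrite e2; apply: ideal_mulr => //; exact: IM.
by apply: IM; rewrite subrXX mulrA; exact: ideal_mulr.
Qed.

End TopDvd.

(** * Local structure at a prime, and almost prime elements *)

Section AlmostPrime.
Variable R : idomainType.
Hypothesis dR : dedekind R.
Implicit Types (I J P Q : set R) (x y r : R).

Section UniquePrime.
Variables (P : set R) (r : R).
Hypotheses (pP : prime_ideal P) (r0 : r != 0) (Pr : P r).
Hypothesis uP : forall Q, prime_ideal Q -> Q r -> Q = P.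

(** [P] is an associated prime of [R/(r)]: a maximal proper ideal among the [colon y] is prime and
    contains [r], so it equals [P]. *)
Lemma colon_prime : exists b, ~ principal r b /\
  forall q, P q -> principal r (b * q).
Proof.
have [_ noeR _ _] := dR; have [iP P1 _] := pP; have iE := ideal_principal r.
have [E0 ED EM] := iE.
pose colon y : set R := [set z | principal r (y * z)].
have icolon y : is_ideal (colon y).
  split; first by rewrite /colon /= mulr0.
  - by move=> u v; rewrite /colon /= mulrDr; exact: ED.
  - by move=> a u; rewrite /colon /= mulrCA; exact: EM.
have main I : is_ideal I -> forall y, I = colon y -> ~ principal r y ->
    exists b, ~ principal r b /\ forall q, P q -> principal r (b * q).
  move: I; apply: (noetherian_ind noeR) => I iI IH y Iy ny.
  have I1 : ~ I 1 by rewrite Iy /colon /= mulr1.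
  have [pI|/(prime_idealPn iI I1)[u [v [Iuv Iu Iv]]]] := pselect (prime_ideal I).
    exists y; split=> // q; rewrite -(uP pI); first by rewrite Iy.
    by rewrite Iy; exists y; rewrite // mulrC.
  apply: (IH (colon (y * u)) (icolon _)  _ _ (y * u)) => //.
  - by move=> z; rewrite Iy /colon /= mulrAC => Ez; exact: ideal_mulr.
  - by move=> e; apply: Iv; rewrite -e /colon /= -mulrA; move: Iuv; rewrite Iy.
  - by move: Iu; rewrite {1}Iy.
apply: (main _ (icolon 1) 1) => // -[c _ e].
by apply: P1; rewrite -e; exact: ideal_mulr.
Qed.

(* If [b / r] mapped [P] into itself, it would be integral over [R] by the
   Cayley-Hamilton theorem applied to its matrix on generators of [P]. *)
Lemma colon_escape b : ~ principal r b -> (forall q, P q -> principal r (b * q)) ->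
  exists t s, [/\ P t, ~ P s & b * t = r * s].
Proof.
move=> nb bP; apply: contrapT => h.
have [_ noeR closedR _] := dR; have [iP _ _] := pP.
have {}h t s : P t -> b * t = r * s -> P s.
  by move=> Pt e; apply: contrapT => ns; apply: h; exists t, s.
have [l Pl] := noeR P iP.
have /choice[f fP] (i : 'I_(size l)) : exists c : 'I_(size l) -> R,
    b * l`_i = r * \sum_j c j * l`_j.
  have Pli : P l`_i by rewrite Pl; apply: sub_ideal_span; exact: mem_nth.
  have [c _ e] := bP _ Pli; have := h _ _ Pli (esym e).
  by rewrite Pl => /ideal_span_seq[g cg]; exists g; rewrite -cg.
have tr0 : tofrac r != 0 by rewrite tofrac_eq0.
pose z : {fraction R} := tofrac b / tofrac r.
pose M : 'M[R]_(size l) := \matrix_(i, j) f j i.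
have Mz : eigenvalue (map_mx (@tofrac R) M) z.
  apply/eigenvalueP; exists (\row_i tofrac l`_i).
    apply/rowP => j; rewrite !mxE.
    transitivity (tofrac (\sum_i f j i * l`_i)).
      rewrite rmorph_sum; apply: eq_bigr => i _.
      by rewrite !mxE -tofracM mulrC.
    by apply: (mulfI tr0); rewrite -tofracM -fP tofracM /z mulrA (mulrC (tofrac r)) divfK.
  apply/eqP => /rowP v0; move/eqP: r0; apply.
  have [c ->] : exists c : 'I_(size l) -> R, r = \sum_i c i * l`_i.
    by apply: ideal_span_seq; rewrite -Pl.
  apply: big1 => i _; have /eqP := v0 i.
  by rewrite !mxE tofrac_eq0 => /eqP ->; rewrite mulr0.
have [e ze] : exists e : R, z = tofrac e.
  apply: closedR; exists (char_poly M); first exact: char_poly_monic.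
  by rewrite map_char_poly -eigenvalue_root_char.
apply: nb; exists e => //; apply/eqP; rewrite -tofrac_eq tofracM -ze /z.
by rewrite mulrC divfK.
Qed.

(** [t] generates [P] in the localization at [P], with denominators cleared: combine [b * t = r * s]
    with [b * q = r * c] and cancel [r]. *)
Lemma local_uniformizer : exists t s,
  [/\ P t, ~ P s & forall q, P q -> exists c, s * q = t * c].
Proof.
have [b [nb bP]] := colon_prime; have [t [s [Pt ns e]]] := colon_escape nb bP.
exists t, s; split=> // q /bP[c _ ec]; exists c.
by apply: (mulfI r0); rewrite mulrA -e mulrAC -ec; ring.
Qed.

(** The localization at [P] is a valuation ring. If [x] and [y] are both in [P], divide both by the
    uniformizer [t] and induct on [sat x], the contraction of the ideal that [x] generates
    locally. *)
Lemma local_dvd_total x y : x != 0 -> y != 0 ->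
  exists a c, ~ P a /\ (a * x = y * c \/ a * y = x * c).
Proof.
have [_ noeR _ _] := dR; have [iP P1 PP] := pP; have [P0 PD PM] := iP.
have PN a b : ~ P a -> ~ P b -> ~ P (a * b) by move=> na nb /PP[].
have [t [s [Pt ns tP]]] := local_uniformizer.
pose sat u : set R := [set z | exists a c, ~ P a /\ a * z = u * c].
have isat u : is_ideal (sat u).
  split.
  - by exists 1, 0; rewrite !mulr0.
  - move=> v w [a [c [na ac]]] [b [d [nb bd]]]; exists (a * b), (b * c + a * d).
    by split; [exact: PN|rewrite !mulrDr [u * _]mulrCA -ac [u * _]mulrCA -bd; ring].
  - by move=> m v [a [c [na ac]]]; exists a, (m * c); rewrite mulrCA ac; split=> //; ring.
move=> x0 y0; have [I iI Ix] : exists2 I, is_ideal I & I = sat x by exists (sat x).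
move: I iI x y Ix x0 y0; apply: (noetherian_ind noeR) => I iI IH x y Ix x0 y0.
have [Px|nPx] := pselect (P x); last by exists x, y; split=> //; right.
have [Py|nPy] := pselect (P y); last by exists y, x; split=> //; left.
have [x1 e1] := tP x Px; have [y1 e2] := tP y Py.
have s0 : s != 0 by apply/eqP => s0; apply: ns; rewrite s0.
have x10 : x1 != 0.
  by apply/eqP => e; move/eqP: e1; rewrite e mulr0 mulf_eq0 (negbTE s0) (negbTE x0).
have y10 : y1 != 0.
  by apply/eqP => e; move/eqP: e2; rewrite e mulr0 mulf_eq0 (negbTE s0) (negbTE y0).
have t0 : t != 0.
  by apply/eqP => e; move/eqP: e1; rewrite e mul0r mulf_eq0 (negbTE s0) (negbTE x0).
have [||a [c [na ac]]] := IH (sat x1) (isat x1) _ _ x1 y1 erefl x10 y10.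
- move=> z; rewrite Ix => -[a [c [na ac]]]; exists (s * a), (t * c).
  by split; [exact: PN|rewrite -mulrA ac mulrA e1; ring].
(* The ideal grows strictly: [x1] in [sat x] would make [s * a] a multiple of [t], hence an element
   of [P]. *)
- rewrite Ix => e; have [a [c [na ac]]] : sat x x1.
    by rewrite -e; exists 1, 1; rewrite mulr1 mul1r.
  have sa : s * a = t * c by apply: (mulIf x10); rewrite -mulrA ac mulrA e1; ring.
  by have := PN _ _ ns na; rewrite sa; apply; exact: ideal_mulr.
exists (a * s), (s * c); split; first exact: PN.
case: ac => ac; [left|right].
- by rewrite -[a * s * x]mulrA e1 mulrCA ac [t * (_ * _)]mulrA -e2; ring.
- by rewrite -[a * s * y]mulrA e2 mulrCA ac [t * (_ * _)]mulrA -e1; ring.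
Qed.

End UniquePrime.

(** A nonunit [x] lies in [P] alone, so the local multiplier [a] outside [P] is comaximal with [r]
    and [x], and local divisibility becomes global. Either [r] divides [x] and induction applies, or
    [x] divides the irreducible [r]. *)
Lemma almost_prime_dvd_exp r x n c : almost_prime r -> r ^+ n = x * c ->
  exists u j, u \is a GRing.unit /\ x = u * r ^+ j.
Proof.
move=> [[r0 rU irr] [P [[pP Pr] uP]]].
have {}uP Q : prime_ideal Q -> Q r -> Q = P by move=> pQ Qr; rewrite (uP Q).
have [_ noeR _ _] := dR.
have comax a b : (forall Q, prime_ideal Q -> Q a -> ~ Q b) ->
    exists u v, 1 = a * u + v * b.
  move=> h; apply: contrapT => n1.
  have [|Q pQ Qab] := prime_ideal_above noeR (ideal_adjoin b (ideal_principal a)).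
    by case=> _ [v [[u _ <-] e]]; apply: n1; exists u, v.
  apply: (h Q pQ).
  - by apply: Qab; apply: sub_adjoin; exists 1; rewrite ?mulr1.
  - by apply: Qab; apply: mem_adjoin; exact: ideal_principal.
elim: n x => [|n IH] x e.
  exists x, 0; rewrite expr0 mulr1; split=> //.
  by apply/unitrPr; exists c; rewrite -e.
have [xU|xU] := boolP (x \is a GRing.unit); first by exists x, 0; rewrite mulr1.
have x0 : x != 0.
  by apply: contraTneq (expf_neq0 n.+1 r0) => x0; rewrite e x0 mul0r eqxx.
have uPx Q : prime_ideal Q -> Q x -> Q = P.
  move=> pQ Qx; apply: uP => //; apply: (prime_exp (n := n.+1) pQ).
  by rewrite e; have [iQ _ _] := pQ; exact: ideal_mulr.
have [a [d [na [ad|ad]]]] := local_dvd_total pP r0 Pr uP x0 r0.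
- have [|u [v e1]] := comax r a; first by move=> Q pQ Qr; rewrite (uP Q).
  have ex : x = r * (u * x + v * d).
    by rewrite -[LHS]mul1r e1 mulrDl -[v * a * x]mulrA ad; ring.
  have [|w [j [wU ej]]] := IH (u * x + v * d).
    by apply: (mulfI r0); rewrite mulrA -ex -e exprS.
  by exists w, j.+1; split=> //; rewrite ex ej exprS; ring.
- have [|u [v e1]] := comax x a; first by move=> Q pQ Qx; rewrite (uPx Q).
  have er : r = x * (u * r + v * d).
    by rewrite -[LHS]mul1r e1 mulrDl -[v * a * r]mulrA ad; ring.
  have [|wU] := irr _ _ er; first by rewrite (negbTE xU).
  exists (u * r + v * d)^-1, 1; rewrite unitrV expr1; split=> //.
  by rewrite {2}er mulrC mulrK.
Qed.

Lemma irreducible_factor (z : R) : z != 0 -> z \isn't a GRing.unit ->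
  exists p e, irreducible p /\ z = p * e.
Proof.
have [_ noeR _ _] := dR.
move=> z0 zU; have [I iI Iz] : exists2 I, is_ideal I & I = principal z.
  by exists (principal z) => //; exact: ideal_principal.
move: I iI z Iz z0 zU; apply: (noetherian_ind noeR) => I iI IH z Iz z0 zU.
have [irr|nirr] := pselect (irreducible z); first by exists z, 1; rewrite mulr1.
have [x [y [e xU yU]]] : exists x y, [/\ z = x * y, x \isn't a GRing.unit
    & y \isn't a GRing.unit].
  apply: contrapT => h; apply: nirr; split=> // x y e.
  have [xU|xU] := boolP (x \is a GRing.unit); first by left.
  have [yU|yU] := boolP (y \is a GRing.unit); first by right.
  by case: h; exists x, y.
have x0 : x != 0 by apply: contraNneq z0 => x0; rewrite e x0 mul0r.
have [||p [f [ip ex]]] := IH _ (ideal_principal x) _ _ x erefl x0 xU.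
- by rewrite Iz => _ [a _ <-]; exists (y * a); rewrite // e mulrA.
- rewrite Iz => xz; have [a _ za] : principal z x by rewrite -xz; exists 1; rewrite ?mulr1.
  move/negP: yU; apply; apply/unitrPr; exists a; apply: (mulfI x0).
  by rewrite mulrA -e za mulr1.
- by exists p, (f * y); split=> //; rewrite e ex mulrA.
Qed.

Lemma ideal_exp_mem P x n : P x -> ideal_exp P n (x ^+ n).
Proof.
move=> Px; elim: n => // n IH; rewrite exprS.
by apply: sub_ideal_span; exists x => //; exists (x ^+ n).
Qed.

(** By torsion some power of [P] is a principal ideal [(z)]; take an irreducible factor [p] of [z].
    A prime containing [p] contains [n]-th powers of all elements of [P], hence [P] itself. *)
Lemma almost_prime_of_prime P : torsion_class_group R -> prime_ideal P ->
  nonzero_ideal P -> exists p, [/\ irreducible p, P p,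
    forall Q, prime_ideal Q -> Q p -> Q = P &
    forall c, P c -> exists n e, c ^+ n = p * e].
Proof.
move=> torR pP nzP; have [_ noeR _ dim1] := dR; have [iP P1 _] := pP.
have [_ _ maxP] := dim1 P pP nzP.
have [n n0 [a [b [a0 b0 eab]]]] := torR P nzP.
have [z Pz ebz] : exists2 z, P z & b = a * z.
  have : ideal_mul (principal a) (ideal_exp P n) b.
    rewrite eab; apply: sub_ideal_span; exists b; first by exists 1; rewrite ?mulr1.
    by exists 1; rewrite ?mulr1.
  have Pn : ideal_exp P n `<=` P.
    case: n n0 {eab} => // n _; apply: ideal_span_sub => // _ [x Px [y _ <-]].
    exact: ideal_mulr.
  apply: (@ideal_span_sub _ _ [set v | exists2 z, P z & v = a * z]).
    have [P0 PD PM] := iP; split.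
    - by exists 0; rewrite ?mulr0.
    - by move=> _ _ [u Pu ->] [v Pv ->]; exists (u + v); [exact: PD|rewrite mulrDr].
    - by move=> c _ [u Pu ->]; exists (c * u); [exact: PM|rewrite mulrCA].
  move=> _ [_ [c _ <-] [y Py <-]]; exists (c * y); last by rewrite mulrA.
  by have [_ _ PM] := iP; apply: PM; exact: Pn.
have zP c : P c -> exists e, c ^+ n = z * e.
  move=> Pc; have : ideal_mul (principal a) (ideal_exp P n) (a * c ^+ n).
    apply: sub_ideal_span; exists a; first by exists 1; rewrite ?mulr1.
    by exists (c ^+ n) => //; exact: ideal_exp_mem.
  rewrite eab => /(ideal_span_sub (ideal_principal b))[|e _ ebe].
    by move=> _ [_ [d _ <-] [y _ <-]]; exists (d * y); rewrite // mulrA.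
  by exists e; apply: (mulfI a0); rewrite -ebe ebz mulrA.
have z0 : z != 0 by apply: contraNneq b0 => z0; rewrite ebz z0 mulr0.
have [p [e [ip ez]]] := irreducible_factor z0 (prime_nonunit pP Pz).
have uP Q : prime_ideal Q -> Q p -> Q = P.
  move=> pQ Qp; have [iQ Q1 _] := pQ.
  have [|//|QT] := maxP Q iQ; last by case: Q1; rewrite QT.
  move=> c /zP[f ef]; apply: (prime_exp (n := n) pQ).
  by rewrite ef ez -mulrA; exact: ideal_mulr.
have [_ pU _] := ip.
have [Q pQ Qp] := nonunit_prime noeR pU.
exists p; split=> //; first by rewrite -(uP Q).
by move=> c /zP[f ef]; exists n, (e * f); rewrite ef ez mulrA.
Qed.

End AlmostPrime.

(** * Transfer along a homeomorphism: divisibility into powers, units, almost primes *)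

Lemma radical_dvd_homeo (R S : idomainType) (h : golomb S -> golomb R)
    (g : golomb R -> golomb S) : dedekind R -> dedekind S ->
  cancel h g -> cancel g h -> continuous h -> continuous g ->
  forall x y, radical_dvd x y -> radical_dvd (h x) (h y).
Proof.
move=> dR dS hK gK ch cg x y /(radical_top_dvd dS) xy.
exact/(top_dvd_radical dR)/(top_dvd_homeo hK gK ch cg).
Qed.

Lemma unitr_neq0 (R : idomainType) (u : R) : u \is a GRing.unit -> u != 0.
Proof. by apply: contraTneq => ->; rewrite unitr0. Qed.

(** Expresses units through the preserved relation; testing against [1] is enough. *)
Lemma unit_radical_dvd (R : idomainType) (x : golomb R) :
  sval x \is a GRing.unit <-> forall y, radical_dvd x y.
Proof.
split=> [xU y|]; first by exists 1, ((sval x)^-1 * sval y); rewrite mulVKr ?expr1.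
move/(_ (exist _ 1 (oner_neq0 R))) => [n [c]]; rewrite expr1n => e.
by apply/unitrPr; exists c.
Qed.

Lemma unit_homeo (R S : idomainType) (h : golomb S -> golomb R)
    (g : golomb R -> golomb S) : dedekind R -> dedekind S ->
  cancel h g -> cancel g h -> continuous h -> continuous g ->
  forall x, sval (h x) \is a GRing.unit -> sval x \is a GRing.unit.
Proof.
move=> dR dS hK gK ch cg x /unit_radical_dvd hx; apply/unit_radical_dvd => y.
by rewrite -(hK x) -(hK y); apply: (radical_dvd_homeo dS dR gK hK cg ch).
Qed.

Lemma closure_pow_homeo (R S : idomainType) (h : golomb S -> golomb R)
    (g : golomb R -> golomb S) (b : golomb S) (p : golomb R) v l :
  dedekind R -> dedekind S ->
  cancel h g -> cancel g h -> continuous h -> continuous g ->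
  almost_dirichlet R ->
  radical_dvd (h b) p -> v \is a GRing.unit -> (0 < l)%N ->
  sval (g p) = v * sval b ^+ l -> closure (pow (h b)) p.
Proof.
move=> dR dS hK gK ch cg adR [n [e pe]] vU l0 gp V /nbhs_coset[I [nzI cI IV]].
have iI := proj1 nzI.
have : nbhs (g p) (h @^-1` coset (sval p) I).
  by apply: ch; rewrite gK; exact: coset_nbhs.
move=> /nbhs_coset[J [nzJ cJ JI]]; have iJ := proj1 nzJ; have [_ _ JM] := iJ.
have cJb : comaximal J (sval b).
  apply: (@comaximal_dvd _ J (sval (g p)) (sval b) 1 (v * sval b ^+ l.-1)) => //.
  by rewrite expr1 gp mulrCA -exprS prednK.
have : nbhs (h b) (g @^-1` coset (sval b) J).
  by apply: cg; rewrite hK; exact: coset_nbhs.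
move=> /nbhs_coset[I1 [nzI1 cI1 I1J]]; have iI1 := proj1 nzI1.
have cIb := comaximal_dvd iI pe cI.
(* Closeness modulo [I1] puts [g r] near [b]; closeness modulo [I] later allows replacing [r] by
   [h b]. *)
have [|r [i [Ii I1i] ri] apr] := adR (coset (sval (h b)) (I `&` I1)).
  exists (sval (h b)), (I `&` I1); split=> //; first exact: (svalP (h b)).
    exact: nonzero_ideal_setI.
  apply/comaximalP; first exact: ideal_setI.
  exact: comaximal_setI.
have [j Jj sj] : coset (sval b) J (g r) by apply: I1J; exists i.
have s0 : v * sval (g r) ^+ l != 0.
  by rewrite mulf_neq0 ?expf_neq0 ?(svalP (g r)) //; exact: unitr_neq0.
pose s' : golomb S := exist _ (v * sval (g r) ^+ l) s0.
have [k Ik sk] : coset (sval p) I (h s').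
  apply: JI; exists (v * (sval (g r) ^+ l - sval b ^+ l)); last by rewrite /= gp; ring.
  by apply: JM; apply: ideal_congX => //; rewrite sj addrAC subrr add0r.
have [m [f ef]] : radical_dvd (h s') (h (g r)).
  apply: (radical_dvd_homeo dR dS hK gK ch cg); exists l, v^-1.
  by rewrite /= mulrC mulKr.
rewrite gK in ef; have [u [q [uU eq]]] := almost_prime_dvd_exp dR apr ef.
(* For [q = 0] the element [h s'] is a unit, hence so are [s'], [g r] and finally [r]. *)
have q0 : (0 < q)%N.
  rewrite lt0n; apply/eqP => q0; move: eq; rewrite q0 expr0 mulr1 => eq.
  have [[_ /negP rU _] _] := apr; apply: rU.
  have : sval s' \is a GRing.unit by apply: (unit_homeo dR dS hK gK ch cg); rewrite eq.
  rewrite /= unitrM vU /= unitrX_pos //.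
  exact: (unit_homeo dS dR gK hK cg ch).
have hb0 : u * sval (h b) ^+ q != 0.
  by rewrite mulf_neq0 ?expf_neq0 ?(svalP (h b)) //; exact: unitr_neq0.
exists (exist _ (u * sval (h b) ^+ q) hb0); split; first by exists u, q.
have [_ ID IM] := iI.
apply: IV; exists (k + u * (sval (h b) ^+ q - sval r ^+ q)).
  apply: ID => //; apply: (IM); apply: ideal_congX => //.
  have -> : sval (h b) - sval r = - 1 * i by rewrite ri; ring.
  exact: IM.
by rewrite /= addrA -sk eq; ring.
Qed.

Theorem theorem6p8 (R S : idomainType) (h : golomb S -> golomb R) :
  dedekind R -> torsion_class_group R ->
  power_separated R -> almost_dirichlet R ->
  dedekind S -> homeomorphism h ->
  forall b : golomb S, almost_prime (sval b) -> almost_prime (sval (h b)).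
Proof.
move=> dR torR psR adR dS [g [hK gK ch cg]] b apb.
have [_ noeR _ dim1] := dR.
have hbU : sval (h b) \isn't a GRing.unit.
  have [[_ bU _] _] := apb; apply: contraNN bU.
  exact: (unit_homeo dR dS hK gK ch cg).
have [P pP Pc] := nonunit_prime noeR hbU.
have nzP : nonzero_ideal P.
  by split; [case: pP|exists (sval (h b)); last exact: (svalP (h b))].
have [p [[p0 pU irrp] Pp uP Pdvd]] := almost_prime_of_prime dR torR pP nzP.
pose p' : golomb R := exist _ p p0.
(* [h b] is in [P], so [p] divides one of its powers; pull this back by [g]. *)
have [n [e be]] : radical_dvd (g p') b.
  rewrite -(hK b); apply: (radical_dvd_homeo dS dR gK hK cg ch).
  exact: Pdvd.
have [v [l [vU gp]]] := almost_prime_dvd_exp dS apb be.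
have l0 : (0 < l)%N.
  rewrite lt0n; apply/eqP => l0; move/negP: pU; apply.
  apply: (unit_homeo dS dR gK hK cg ch (x := p')).
  by rewrite gp l0 expr0 mulr1.
have bp : radical_dvd (h b) p'.
  rewrite -(gK p'); apply: (radical_dvd_homeo dR dS hK gK ch cg).
  by exists 1, (v * sval b ^+ l.-1); rewrite expr1 gp mulrCA -exprS prednK.
have uPc Q : prime_ideal Q -> Q (sval (h b)) -> Q = P.
  move=> pQ Qc; have [m [f ef]] := bp; apply: uP => //.
  apply: (prime_exp (n := m) pQ); rewrite ef.
  by have [iQ _ _] := pQ; exact: ideal_mulr.
have : (closure (pow (h b)) `&` golomb_at P) p'.
  split; last by split.
  exact: (closure_pow_homeo dR dS hK gK ch cg adR bp vU l0 gp).
rewrite psR; [|exact: dim1|by split].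
move=> [u [[|m] [uU m0 /= pe]]] //.
(* [p = u * h b ^+ m.+1] is irreducible and [h b] is not a unit, so the cofactor is a unit and [h b]
   is an associate of [p]. *)
have [|cU|wU] := irrp (sval (h b)) (u * sval (h b) ^+ m).
- by rewrite pe exprS mulrCA.
- by rewrite cU in hbU.
split; last by exists P; split=> // Q [pQ Qc]; rewrite (uPc Q).
split=> //; first exact: (svalP (h b)).
move=> x y xy.
have [||] := irrp (u * sval (h b) ^+ m * x) y.
- by rewrite pe exprSr mulrA {2}xy mulrA.
- by rewrite unitrM wU; left.
- by right.
Qed.
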